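(* Let $n$ be a nonnegative integer, let $\ell$ be an odd prime with $\ell\equiv -1\pmod{8}$, and let $r$ be a positive integer with $\ell\nmid r$. Then $$\overline{p}(\ell^2 n+r\ell)\equiv 0\pmod{16}.$$
   Context: An overpartition of a nonnegative integer $n$ is a partition of $n$ in which the first occurrence of each distinct part may be overlined. $\overline{p}(n)$ denotes the number of overpartitions of $n$ (with $\overline{p}(0)=1$); for example $\overline{p}(3)=8$. Its generating function is $\sum_{n\ge 0}\overline{p}(n)q^n=\prod_{m\ge 1}\frac{1+q^m}{1-q^m}$. *)

(* Defs.v *)
From mathcomp Require Import all_boot.

Set Implicit Arguments.
Unset Strict Implicit.
Unset Printing Implicit Defensive.

(* An overpartition is written as the nonincreasing sequence of its parts, each
   paired with a boolean that tells whether this occurrence is overlined; since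
   [index] returns the first position, only first occurrences can be. *)
Definition is_overpartition (n : nat) (s : seq (nat * bool)) : bool :=
  let parts := unzip1 s in
  [&& sorted geq parts,
      all (fun p => 0 < p) parts,
      sumn parts == n
    & all (fun i => nth false (unzip2 s) i ==>
                    (index (nth 0 parts i) parts == i))
          (iota 0 (size s))].

(* The parts and the length of an overpartition of n are at most n, so that
   counting in a finite type of bounded sequences misses none of them. *)
Lemma overpartition_bounded (n : nat) (s : seq (nat * bool)) :
  is_overpartition n s ->
  (size s <= n) && all (fun u : nat * bool => u.1 <= n) s.
Proof.
case/and4P=> _ pos_s /eqP <- _; elim: s pos_s => [|u s IHs] //=.
case/andP=> u_gt0 /IHs /andP[le_s all_s].
rewrite -add1n leq_add //= leq_addr /=.
by apply: sub_all all_s => v /leq_trans-> //; apply: leq_addl.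
Qed.

Definition overpartitions (n : nat) : {set n.-bseq ('I_n.+1 * bool)} :=
  [set s : n.-bseq ('I_n.+1 * bool) |
    is_overpartition n [seq (val u.1, u.2) | u <- s]].

Definition pbar (n : nat) : nat := #|overpartitions n|.

(* Main.v *)
Require Import Defs.
From mathcomp Require Import all_boot all_algebra all_field ring zify.

(** Write S for the series of (-1)^j q^(j^2) over j >= 1. Gauss's identity says
    that the generating function of overpartitions is the inverse of the theta
    series 1 + 2 S [pbar_gf]. Since (1 + 2 S)(1 - 2 S + 4 S^2 - 8 S^3) equals
    1 - 16 S^4, the generating function is congruent to
    1 - 2 S + 4 S^2 - 8 S^3 modulo 16.

    Let N be the argument in the theorem. The prime l divides N while l^2 does
    not. As l = 7 mod 8, the element -1 is a non-square modulo l and 2 is a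
    square, so -1 and -2 are both non-squares; hence i^2 + j^2 or i^2 + 2 j^2
    can be divisible by l only if l divides i and j, and then it is divisible
    by l^2 [norm_form_dvd]. So N has neither of these forms. The first form
    (where j may vanish) kills the coefficients of 1, S and S^2 at N. For S^3,
    squaring is additive modulo 2, so that S^3 = S(q) S(q)^2 is congruent to
    the product of S(q) and the sum of the q^(2 j^2), whose coefficient at N
    vanishes by the second form; thus 8 S^3 contributes a multiple of 16
    [pbar_mod16].

    Gauss's identity is proved by telescoping a closed form for the error made
    when the theta series is cut after k terms. Series are handled as elements
    of a commutative ring in which q^(N+1) = 0, which makes every sum and
    product finite and every 1 - q^i with i > 0 invertible. Such a ring is the
    quotient of the polynomials over the integers by X^(N+1), whose elements
    keep the coefficients up to N.

    The product formula for overpartitions comes from deleting the first part: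
    an overpartition is a chain for a transitive relation on parts, and the
    number of chains with bounded first part satisfies a linear recurrence
    [tailsS]. *)

Import GRing.Theory.

Set Implicit Arguments.
Unset Strict Implicit.
Unset Printing Implicit Defensive.

(** * Overpartitions as chains *)

(** The condition on two consecutive parts of an overpartition: a part repeats
    its predecessor only without an overline. The relation is transitive, so an
    overpartition is the same thing as a sorted sequence for it. *)
Definition may_follow (u v : nat * bool) :=
  (v.1 < u.1) || (v.1 == u.1) && ~~ v.2.

Lemma may_follow_trans : transitive may_follow.
Proof.
move=> [b x] [a y] [c z]; rewrite /may_follow /=.
by case: x y z => [] [] []; lia.
Qed.

(** By induction on the sequence. In front of t, a part u leaves the condition
    on each position of t as it was, unless that position repeats the part u,
    in which case it is no longer a first occurrence. By transitivity, the
    comparison with all of t is what sortedness adds when u is prepended. *)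
Lemma sorted_may_followE s :
  sorted geq (unzip1 s) &&
  all (fun i => nth false (unzip2 s) i ==>
         (index (nth 0 (unzip1 s) i) (unzip1 s) == i)) (iota 0 (size s))
  = sorted may_follow s.
Proof.
elim: s => //= u t IH.
rewrite (path_sortedE may_follow_trans) -IH path_sortedE; last first.
  by move=> b a c /= ba cb; exact: leq_trans cb ba.
rewrite eqxx implybT /= (iotaDl 1 0) all_map.
have -> : all (may_follow u) t =
    all (geq u.1) (unzip1 t) && all (fun v => v.2 ==> (u.1 != v.1)) t.
  rewrite all_map -all_predI; apply: eq_all => -[p b].
  by rewrite /may_follow /=; case: b; lia.
rewrite -!andbA; congr (_ && _); rewrite andbCA; congr (_ && _).
have all_nthE (P : pred (nat * bool)) :
    all P t = all (fun i => P (nth (0, false) t i)) (iota 0 (size t)).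
  by rewrite -{1}(mkseq_nth (0, false) t) all_map.
rewrite all_nthE -all_predI.
apply: eq_in_all => i; rewrite mem_iota /= => it; rewrite add0n.
rewrite (nth_map (0, false)) // (nth_map (0, false)) //.
case: (nth _ t i) => p [] //=; case: (u.1 == p) => //=.
Qed.

Lemma is_overpartitionE n s :
  is_overpartition n s =
  [&& sorted may_follow s, all (fun u => 0 < u.1) s & sumn (unzip1 s) == n].
Proof.
rewrite -sorted_may_followE /is_overpartition all_map.
by rewrite -!andbA; congr (_ && _); rewrite [in RHS]andbC -andbA.
Qed.

Definition count_seqs n (P : pred (seq (nat * bool))) :=
  #|[set s : n.-bseq ('I_n.+1 * bool) | P [seq (val u.1, u.2) | u <- s]]|.

Definition bounded n (s : seq (nat * bool)) :=
  (size s <= n) && all (fun u => u.1 <= n) s.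

(** Counting goes through duplicate-free lists of sequences of unbounded type,
    because splitting off a first part changes the bound in the bounded type of
    [count_seqs]. *)
Lemma count_seqs_listing n (P : pred (seq (nat * bool))) :
  (forall s, P s -> bounded n s) ->
  exists L, [/\ uniq L, L =i P & size L = count_seqs n P].
Proof.
move=> Pb; pose conv (s : n.-bseq ('I_n.+1 * bool)) := [seq (val u.1, u.2) | u <- s].
exists [seq conv s | s in [set s | P (conv s)]]; split.
- rewrite map_inj_uniq ?enum_uniq // => s t st; apply/val_inj; apply: inj_map st.
  by move=> [p b] [p' b'] /= [/val_inj-> ->].
- move=> s; apply/mapP/idP => [[t]|Ps].
    by rewrite mem_enum inE => Pt ->.
  have /andP[s_size /allP s_le] := Pb s Ps.
  have t_size : size [seq (inord u.1 : 'I_n.+1, u.2) | u <- s] <= n by rewrite size_map.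
  have convK : conv (Bseq t_size) = s.
    rewrite /conv /= -map_comp -[RHS]map_id; apply/eq_in_map => -[p b] /s_le /= pn.
    by rewrite inordK.
  by exists (Bseq t_size); rewrite ?convK // mem_enum inE convK.
- by rewrite size_map -cardE.
Qed.

Lemma count_seqsP n (P : pred (seq (nat * bool))) (L : seq (seq (nat * bool))) :
  (forall s, P s -> bounded n s) -> uniq L -> L =i P -> count_seqs n P = size L.
Proof.
move=> /count_seqs_listing[M [uM memM <-]] uL memL; apply/perm_size/uniq_perm => // s.
by rewrite memM memL.
Qed.

(** The sequences that can come after the part m: they consist of parts at most
    m, and their copies of m are not overlined. The overline of m itself is
    immaterial, so the boolean [false] below is a mere placeholder. *)
Definition tail_ok m n (s : seq (nat * bool)) :=
  [&& path may_follow (m, false) s, all (fun u => 0 < u.1) s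
    & sumn (unzip1 s) == n].

Definition tails m n := count_seqs n (tail_ok m n).

Lemma tail_ok_bounded m n s : tail_ok m n s -> bounded n s.
Proof.
case/and3P => /path_sorted s_sorted s_pos s_sum; apply: overpartition_bounded.
by rewrite is_overpartitionE s_sorted s_pos.
Qed.

Lemma pbar_tails m n : n < m -> pbar n = tails m n.
Proof.
move=> nm; have [L [uL memL sL]] := count_seqs_listing (@tail_ok_bounded m n).
rewrite -[RHS]sL; apply: count_seqsP => // [s|s]; first exact: overpartition_bounded.
rewrite memL -!topredE /= is_overpartitionE /tail_ok.
apply/idP/idP => /and3P[s_sorted s_pos s_sum]; apply/and3P; split=> //.
  by rewrite (path_sorted s_sorted).
rewrite path_min_sorted //.
have s_ov : is_overpartition n s by rewrite is_overpartitionE s_sorted s_pos.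
have /andP[_] := overpartition_bounded s_ov.
by apply: sub_all => u un; rewrite /may_follow (leq_ltn_trans un nm).
Qed.

Lemma tails0 n : tails 0 n = (n == 0).
Proof.
rewrite /tails (@count_seqsP n _ (if n == 0 then [:: [::]] else [::])).
- by case: eqP.
- exact: tail_ok_bounded.
- by case: ifP.
move=> s; transitivity ((s == [::]) && (n == 0)).
  by case: ifP; rewrite ?inE ?andbT ?andbF.
rewrite -[RHS]topredE /= /tail_ok eq_sym; case: s => [|[[|p] b] s] //=.
by rewrite andbF.
Qed.

(** A tail after m+1 that is not a tail after m starts with m+1, without
    overline, or with an overlined m; a part m can be overlined only if it is
    positive. What remains is again an arbitrary tail after the part removed. *)
Lemma tailsS m n :
  tails m.+1 n = tails m n + (if m.+1 <= n then tails m.+1 (n - m.+1) else 0)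
                 + (if 0 < m <= n then tails m (n - m) else 0).
Proof.
have listing := fun k j => count_seqs_listing (@tail_ok_bounded k j).
have [A [uA memA sA]] := listing m n.
have [B [uB memB sB]] := listing m.+1 (n - m.+1).
have [C [uC memC sC]] := listing m (n - m).
have mem_cons v (L : seq (seq (nat * bool))) u t :
    (u :: t \in [seq v :: s | s <- L]) = (u == v) && (t \in L).
  apply/mapP/andP => [[s sL [-> ->]]|[/eqP-> tL]]; first by rewrite eqxx.
  by exists t.
have mem_cons0 v (L : seq (seq (nat * bool))) : [::] \in [seq v :: s | s <- L] = false.
  by apply/mapP => -[].
have uniq_cons v (L : seq (seq (nat * bool))) : uniq L -> uniq [seq v :: s | s <- L].
  by move=> uL; rewrite map_inj_uniq // => s t [].
pose B' := if m.+1 <= n then [seq (m.+1, false) :: s | s <- B] else [::].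
pose C' := if 0 < m <= n then [seq (m, true) :: s | s <- C] else [::].
have sizeB : size B' = if m.+1 <= n then tails m.+1 (n - m.+1) else 0.
  by rewrite /B'; case: ifP; rewrite // size_map sB.
have sizeC : size C' = if 0 < m <= n then tails m (n - m) else 0.
  by rewrite /C'; case: ifP; rewrite // size_map sC.
rewrite -sizeB -sizeC -[tails m n]sA -!size_cat; apply: count_seqsP.
- exact: tail_ok_bounded.
- rewrite !cat_uniq uA -!andbA; apply/and5P; split=> //.
  + apply/hasPn => s; rewrite /B'; case: ifP => // _ /mapP[t _ ->].
    by rewrite memA -topredE /= /tail_ok /= /may_follow /=; lia.
  + by rewrite /B'; case: ifP => // _; apply: uniq_cons.
  + apply/hasPn => s; rewrite mem_cat negb_or /C' /B'.
    case: ifP => // _ /mapP[t _ ->]; apply/andP; split.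
      by rewrite memA -topredE /= /tail_ok /= /may_follow /=; lia.
    by case: ifP => // _; rewrite mem_cons xpair_eqE andbF.
  + by rewrite /C'; case: ifP => // _; apply: uniq_cons.
move=> [|[p b] t].
  by rewrite !mem_cat memA /B' /C'; do 2 (case: ifP => _); rewrite ?mem_cons0 !orbF.
have path_eq c : path may_follow (p, c) t = path may_follow (p, false) t by case: t.
have memB' : ((p, b) :: t \in B') =
    [&& p == m.+1, ~~ b, m.+1 <= n & tail_ok m.+1 (n - m.+1) t].
  rewrite /B'; case: ifP => _; last by rewrite !andbF.
  by rewrite mem_cons xpair_eqE memB eqbF_neg -andbA.
have memC' : ((p, b) :: t \in C') =
    [&& p == m, b, 0 < m <= n & tail_ok m (n - m) t].
  rewrite /C'; case: ifP => _; last by rewrite !andbF.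
  by rewrite mem_cons xpair_eqE memC eqb_id -andbA.
rewrite !mem_cat memA memB' memC' -!topredE /tail_ok /= path_eq /may_follow /=.
have [pm|pm] := eqVneq p m.+1.
  rewrite pm; case: b {memB' memC'}; rewrite /= ?ltnn ?ltnSn; lia.
have [pm'|pm'] := eqVneq p m.
  rewrite pm'; case: b {memB' memC'}; rewrite /=; lia.
have -> : (p < m.+1) = (p < m) by lia.
by rewrite /= !orbF.
Qed.

(** * Gauss's identity *)

Section Gauss.
Local Open Scope ring_scope.
Variables (R : comNzRingType) (N : nat) (q : R).
Hypothesis qN : q ^+ N.+1 = 0.

(* The inverse of 1 - q^i for i > 0, as a geometric sum. *)
Let e i : R := \sum_(j < N.+1) q ^+ (i * j).
(* The generating functions of overpartitions whose parts are all at least m,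
   without restriction for V, and with no overlined m for W. *)
Let V m : R := \prod_(m <= i < N.+1) ((1 + q ^+ i) * e i).
Let W m : R := e m * V m.+1.
(* The error term of the theta series cut after k terms, up to the factor
   2 (-1)^k C k. *)
Let U k : R := \sum_(k.+1 <= m < N.+1) q ^+ (k.+1 * m) * W m.
Let C k : R := \prod_(1 <= i < k.+1) ((1 + q ^+ i) * e i).
Let Phi k : R := 1 + 2 * \sum_(1 <= j < k.+1) (-1) ^+ j * q ^+ (j ^ 2).

Lemma nilp_expr m : (N < m)%N -> q ^+ m = 0.
Proof. by move=> h; rewrite -(subnK h) exprD qN mulr0. Qed.

Lemma geometric_inv i : (0 < i)%N -> (1 - q ^+ i) * e i = 1.
Proof.
move=> i_gt0; have := subrX1 (q ^+ i) N.+1.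
rewrite -[in X in X - 1]exprM (nilp_expr (m := (i * N.+1)%N)) ?leq_pmull //.
have -> : \sum_(j < N.+1) (q ^+ i) ^+ j = e i.
  by apply: eq_bigr => j _; rewrite -exprM.
by move=> h; rewrite -opprB mulNr -h sub0r opprK.
Qed.

Lemma V_W m : (m <= N)%N -> V m = (1 + q ^+ m) * W m.
Proof. by move=> h; rewrite /W /V big_ltn ?ltnS // mulrA. Qed.

Lemma VS_W m : (0 < m)%N -> V m.+1 = (1 - q ^+ m) * W m.
Proof. by move=> h; rewrite /W mulrA geometric_inv ?mul1r. Qed.

(** V m - V (m+1) counts the overpartitions with smallest part m, which is
    2 q^m W m; the sum over m telescopes. *)
Lemma error_term0 : V 1 = 1 + 2 * U 0.
Proof.
have : \sum_(1 <= m < N.+1) (V m.+1 - V m) = - (2 * U 0).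
  rewrite /U mulr_sumr -sumrN; apply: eq_big_nat => m /andP[m_gt0 mN].
  by rewrite (VS_W m_gt0) V_W // mul1n; ring.
rewrite telescope_sumr // [V N.+1]big_geq // => h.
by rewrite -[2 * _]opprK -h; ring.
Qed.

(** For each m, the terms of U k and U (k-1), with the factors 1 + q^k and
    1 - q^k of the left-hand side, combine to
    q^(k m) ((1 + q^m) W m - q^k (1 - q^m) W m), which is
    q^(k m) V m - q^(k (m+1)) V (m+1), so that the sum over m >= k telescopes.
    The right-hand side is the first term q^(k^2) V k of the telescoped sum,
    less the term m = k that is missing from U k. *)
Lemma error_term_rec k : (0 < k <= N)%N ->
  (1 + q ^+ k) * U k + (1 - q ^+ k) * U k.-1 = q ^+ (k ^ 2) * (1 - q ^+ k) * V k.
Proof.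
move=> /andP[k_gt0 kN].
(* The upper end of the telescoped sum vanishes since k > 0. *)
have tele :
    \sum_(k <= m < N.+1) (q ^+ (k * m.+1) * V m.+1 - q ^+ (k * m) * V m) =
    - (q ^+ (k ^ 2) * V k).
  rewrite (telescope_sumr (fun m => q ^+ (k * m) * V m)) ?leqW //.
  by rewrite nilp_expr ?leq_pmull // mul0r sub0r mulnn.
have -> : U k = \sum_(k <= m < N.+1) q ^+ (k.+1 * m) * W m - q ^+ (k.+1 * k) * W k.
  by rewrite [\sum_(k <= m < _) _]big_ltn ?ltnS // addrC addKr.
have -> : U k.-1 = \sum_(k <= m < N.+1) q ^+ (k * m) * W m by rewrite /U prednK.
rewrite mulrBr 2!mulr_sumr.
have h m : (k <= m < N.+1)%N ->
    (1 + q ^+ k) * (q ^+ (k.+1 * m) * W m)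
      + (1 - q ^+ k) * (q ^+ (k * m) * W m) =
    - (q ^+ (k * m.+1) * V m.+1 - q ^+ (k * m) * V m).
  move=> /andP[km mN]; rewrite (VS_W (leq_trans k_gt0 km)) V_W //.
  rewrite mulSn mulnS !exprD; ring.
rewrite addrAC -big_split /= (eq_big_nat _ _ h) sumrN tele V_W // mulSn exprD -mulnn.
ring.
Qed.

Lemma V1_split k : (0 < k <= N.+1)%N -> V 1 = C k.-1 * V k.
Proof.
by move=> /andP[k0 kN]; rewrite /V /C (big_cat_nat (n:=k)) //= prednK.
Qed.

(** By induction on k: the error terms for k-1 and k differ by the new term
    2 (-1)^k q^(k^2) of the theta series times V 1 = C (k-1) V k, which is the
    relation [error_term_rec] multiplied by C (k-1) e k. *)
Lemma theta_partial k : (k <= N)%N -> V 1 * Phi k = 1 + 2 * (-1) ^+ k * C k * U k.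
Proof.
elim: k => [|k IH] kN; first by rewrite /Phi /C !big_geq // error_term0; ring.
have -> : Phi k.+1 = Phi k + 2 * ((-1) ^+ k.+1 * q ^+ (k.+1 ^ 2)).
  by rewrite /Phi big_nat_recr //=; ring.
rewrite mulrDr IH ?(ltnW kN) // (@V1_split k.+1) ?ltnS ?(ltnW kN) //=.
have /(congr1 (fun x => e k.+1 * x)) := @error_term_rec k.+1 kN.
have -> : C k.+1 = C k * ((1 + q ^+ k.+1) * e k.+1) by rewrite /C big_nat_recr.
move=> /= h; have := geometric_inv (ltn0Sn k).
set x := q ^+ _ in h *; set E := e _ in h *; set Q := q ^+ _ in h *; rewrite exprS.
move=> xE.
have main : C k * ((1 + x) * E) * U k.+1 = C k * (Q * V k.+1 - U k).
  transitivity (C k * (E * ((1 + x) * U k.+1 + (1 - x) * U k)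
                       - ((1 - x) * E) * U k)); first by ring.
  rewrite h; transitivity (C k * (((1 - x) * E) * (Q * V k.+1 - U k))).
    by ring.
  by rewrite xE mul1r.
rewrite -(mulrA _ (C k * _)) main; ring.
Qed.

(** Gauss's identity: the error term vanishes once k reaches N, and the product
    formula determines h because the 1 - q^i are invertible. *)
Lemma gauss_theta (h : R) :
  \prod_(1 <= i < N.+1) (1 - q ^+ i) * h = \prod_(1 <= i < N.+1) (1 + q ^+ i) ->
  h * (1 + 2 * \sum_(1 <= j < N.+1) (-1) ^+ j * q ^+ (j ^ 2)) = 1.
Proof.
move=> hh.
have V1 : V 1 = h.
  rewrite /V big_split /= -hh mulrAC -big_split /= big_nat big1 ?mul1r //.
  by move=> i /andP[i0 _]; rewrite geometric_inv.
by rewrite -V1 theta_partial // /U big_geq // mulr0 addr0.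
Qed.

End Gauss.

(** * The generating function of overpartitions *)

Section TruncatedSeries.
Local Open Scope ring_scope.

Lemma mulX_truncated (R : comNzRingType) N (q : R) (c : nat -> nat) a :
  q ^+ N.+1 = 0 ->
  q ^+ a * \sum_(n < N.+1) (c n)%:R * q ^+ n =
  \sum_(n < N.+1) (if (a <= n)%N then c (n - a)%N else 0%N)%:R * q ^+ n.
Proof.
move=> qN; elim: a c => [|a IH] c.
  by rewrite mul1r; apply: eq_bigr => n _; rewrite subn0.
rewrite exprSr -mulrA.
have -> : q * \sum_(n < N.+1) (c n)%:R * q ^+ n =
    \sum_(n < N.+1) (if (0 < n)%N then c n.-1 else 0%N)%:R * q ^+ n.
  rewrite big_ord_recr [RHS]big_ord_recl /= mul0r add0r mulrDr mulrCA -exprS qN.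
  rewrite mulr0 addr0 mulr_sumr; apply: eq_bigr => n _.
  by rewrite mulrCA -exprS.
rewrite (IH (fun n => if (0 < n)%N then c n.-1 else 0%N)).
apply: eq_bigr => n _; congr (_%:R * _).
have [an|na] := ltnP a n; first by rewrite ltnW // subn_gt0 an -subnS.
by case: ifP => // an; have -> : (n - a = 0)%N by lia.
Qed.

Section GeneratingFunction.
Variables (R : comNzRingType) (N : nat) (q : R).
Hypothesis qN : q ^+ N.+1 = 0.

Let G m : R := \sum_(n < N.+1) (tails m n)%:R * q ^+ n.

Lemma tails_gf0 : G 0 = 1.
Proof.
rewrite /G big_ord_recl tails0 mul1r big1 ?addr0 // => n _.
by rewrite tails0 mul0r.
Qed.

(** This is [tailsS] read on generating functions, where removing a part m is
    multiplication by q^m. *)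
Lemma tails_gfS m : (1 - q ^+ m.+1) * G m.+1 = if m is 0 then 1 else (1 + q ^+ m) * G m.
Proof.
have tailsE : G m.+1 = G m + q ^+ m.+1 * G m.+1 + (if m is 0 then 0 else q ^+ m * G m).
  have -> : (if m is 0 then 0 else q ^+ m * G m) =
      \sum_(n < N.+1) (if (0 < m <= n)%N then tails m (n - m) else 0%N)%:R * q ^+ n.
    case: m => [|m]; first by rewrite big1 // => n _; rewrite mul0r.
    by rewrite mulX_truncated.
  rewrite mulX_truncated // -!big_split /=; apply: eq_bigr => n _.
  by rewrite tailsS !natrD !mulrDl.
rewrite mulrBl mul1r {1}tailsE addrAC addrK.
by case: m {tailsE} => [|m]; rewrite ?tails_gf0 ?addr0 // mulrDl mul1r.
Qed.

Lemma tails_gf_prod m :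
  \prod_(1 <= i < m.+1) (1 - q ^+ i) * ((1 - q ^+ m.+1) * G m.+1) =
  \prod_(1 <= i < m.+1) (1 + q ^+ i).
Proof.
elim: m => [|m IH]; first by rewrite !big_geq // tails_gfS mul1r.
by rewrite tails_gfS big_nat_recr // [RHS]big_nat_recr //= -IH; ring.
Qed.

(** Tails after N+1 are all the overpartitions of weight at most N, and the
    factor 1 - q^(N+1) that accompanies them in the product formula is 1. *)
Lemma pbar_gf :
  (\sum_(n < N.+1) (pbar n)%:R * q ^+ n) *
  (1 + 2 * \sum_(1 <= j < N.+1) (-1) ^+ j * q ^+ (j ^ 2)) = 1.
Proof.
apply: gauss_theta => //; rewrite -tails_gf_prod qN subr0 mul1r; congr (_ * _).
by apply: eq_bigr => n _; rewrite (@pbar_tails N.+1).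
Qed.

End GeneratingFunction.

End TruncatedSeries.

(** * Coefficients modulo 16 *)

Section Coefficients.
Local Open Scope ring_scope.

Lemma coef_in_qpolyXn (A : comNzRingType) N (p p' : {poly A}) i : (i <= N)%N ->
  in_qpoly 'X^(N.+1) p = in_qpoly 'X^(N.+1) p' -> p`_i = p'`_i.
Proof.
have coefE (u : {poly A}) : (i <= N)%N -> (in_qpoly 'X^(N.+1) u : {poly A})`_i = u`_i.
  move=> iN; rewrite /= mk_monic_Xn /=.
  rewrite {2}(Pdiv.RingMonic.rdivp_eq (monicXn A N.+1) u) coefD coefMXn ltnS iN.
  by rewrite add0r.
by move=> iN pp'; rewrite -(coefE p iN) pp' coefE.
Qed.

Lemma sqr_sum_mod2 (R : comPzRingType) (I : Type) (r : seq I) (a : I -> R) :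
  exists t, (\sum_(i <- r) a i) ^+ 2 = \sum_(i <- r) a i ^+ 2 + 2 * t.
Proof.
elim: r => [|i r [t IH]]; first by exists 0; rewrite !big_nil; ring.
exists (t + a i * \sum_(j <- r) a j); rewrite !big_cons sqrrD IH; ring.
Qed.

Lemma inverse_expansion (R : comNzRingType) (o s : R) : o * (1 + 2 * s) = 1 ->
  o = 1 - 2 * s + 4 * s ^+ 2 - 8 * s ^+ 3 + 16 * (s ^+ 4 * o).
Proof.
move=> os.
transitivity (o * (1 + 2 * s) * (1 - 2 * s + 4 * s ^+ 2 - 8 * s ^+ 3)
              + 16 * (s ^+ 4 * o)); last by rewrite os mul1r.
ring.
Qed.

Lemma coef_signX N j a : N != a -> ((-1) ^+ j * 'X^a : {poly int})`_N = 0.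
Proof.
move=> /negPf Na; rewrite -signr_odd mulr_sign.
by case: odd; rewrite ?coefN coefXn Na ?oppr0.
Qed.

(** The first hypothesis, with i and j allowed to vanish, removes the
    coefficients of 1, S and S^2 from the expansion modulo 16, and the second
    makes the coefficient of S^3 even. *)
Lemma pbar_mod16 N :
  (forall i j, N != i ^ 2 + j ^ 2)%N -> (forall i j, N != i ^ 2 + 2 * j ^ 2)%N ->
  (pbar N = 0 %[mod 16])%N.
Proof.
move=> N11 N12.
(* The signs are a parameter e: they are those of S for d = 1, and are all
   positive in the square of S modulo 2, where d = 2. *)
have coef_S (d : nat) (e : nat -> nat) : (forall i j, N != i ^ 2 + d * j ^ 2)%N ->
    ((\sum_(1 <= i < N.+1) (-1) ^+ i * 'X^(i ^ 2)) *
     (\sum_(1 <= j < N.+1) (-1) ^+ (e j) * 'X^(d * j ^ 2)) : {poly int})`_N = 0.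
  move=> Nd; rewrite mulr_suml coef_sum big1 // => i _.
  rewrite mulr_sumr coef_sum big1 // => j _.
  by rewrite mulrACA -!exprD coef_signX.
pose S : {poly int} := \sum_(1 <= j < N.+1) (-1) ^+ j * 'X^(j ^ 2).
pose O : {poly int} := \sum_(n < N.+1) (pbar n)%:R * 'X^n.
have S1 : S`_N = 0.
  rewrite coef_sum big1 // => j _; apply: coef_signX.
  by have := N11 j 0%N; rewrite addn0.
have S2 : (S ^+ 2)`_N = 0.
  rewrite -[RHS](coef_S 1%N id); last by move=> i j; rewrite mul1n.
  by congr (polyseq (_ * _))`_ _; apply: eq_bigr => j _; rewrite mul1n.
have [t S3] : exists t : int, (S ^+ 3)`_N = 2 * t.
  have [T TE] := sqr_sum_mod2 (index_iota 1 N.+1)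
    (fun j => (-1) ^+ j * 'X^(j ^ 2) : {poly int}).
  exists (S * T)`_N; rewrite exprS TE mulrDr coefD mulrCA !mulr_natl coefMn.
  rewrite -[RHS]add0r; congr (_ + _); rewrite -[RHS](coef_S 2%N (fun=> 0%N)) //.
  congr (polyseq (_ * _))`_ _; apply: eq_bigr => j _.
  by rewrite exprMn sqrr_sign expr0 !mul1r -exprM mulnC.
have qN : 'qX ^+ N.+1 = 0 :> {poly %/ 'X^(N.+1) : {poly int}}.
  rewrite -rmorphXn; apply/val_inj.
  by rewrite /= mk_monic_Xn Pdiv.RingMonic.rmodpp ?monicXn.
have := pbar_gf qN.
have -> : \sum_(n < N.+1) (pbar n)%:R * 'qX ^+ n = in_qpoly 'X^(N.+1) O.
  by rewrite rmorph_sum; apply: eq_bigr => n _; rewrite rmorphM rmorph_nat rmorphXn.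
have -> : \sum_(1 <= j < N.+1) (-1) ^+ j * 'qX ^+ (j ^ 2) = in_qpoly 'X^(N.+1) S.
  by rewrite rmorph_sum; apply: eq_bigr => n _; rewrite rmorphM rmorph_sign rmorphXn.
set o := in_qpoly _ O; set s := in_qpoly _ S => os.
have oE : o = in_qpoly 'X^(N.+1)
    (1 - 2 * S + 4 * S ^+ 2 - 8 * S ^+ 3 + 16 * (S ^+ 4 * O)).
  rewrite rmorphD rmorphB rmorphD rmorphB rmorph1.
  rewrite !(rmorphXn, rmorph_nat, rmorphM) -/s -/o.
  exact: inverse_expansion os.
have := coef_in_qpolyXn (leqnn N) oE.
have -> : O`_N = (pbar N)%:R.
  rewrite coef_sum big_ord_recr /= big1 ?add0r => [|n _].
    by rewrite mulr_natl coefMn coefXn eqxx.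
  by rewrite mulr_natl coefMn coefXn gtn_eqF ?mul0rn.
rewrite !(coefD, coefN, coef1) !mulr_natl !coefMn S1 S2 S3.
have /negPf -> : N != 0%N by exact: N11 0%N 0%N.
rewrite !mul0rn subr0 addr0 add0r => pbarE.
have : (pbar N)%:Z = 16 * ((S ^+ 4 * O)`_N - t) by rewrite -natz pbarE; ring.
lia.
Qed.

End Coefficients.

(** * Binary forms modulo a prime congruent to 7 modulo 8 *)

Lemma big_ord_parity (R : comPzRingType) (f : nat -> R) m :
  (\prod_(i < m.*2.+1) f i =
   (\prod_(j < m) f j.*2.+1) * \prod_(j < m.+1) f j.*2)%R.
Proof.
elim: m => [|m IH]; first by rewrite double0 big_ord0 mul1r !big_ord1.
rewrite doubleS; move: IH; rewrite !big_ord_recr /= => ->.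
by rewrite -!mulrA; congr (_ * _)%R; rewrite [in RHS]mulrCA;
   congr (_ * _)%R; rewrite [in RHS]mulrCA.
Qed.

(** Gauss's lemma for 2. Put h = (l-1)/2, which is 3 modulo 4, so h = 2 m + 1
    with m odd. The even factors of h! are the numbers 2 i with 0 < i <= m, and
    its m + 1 odd factors are congruent to - 2 i for m < i <= h. As m + 1 is
    even the signs cancel, so h! is congruent to 2^h h!. *)
Lemma two_pow_half l : prime l -> l = 7 %[mod 8] -> (2%:R ^+ l./2 = 1 :> 'F_l)%R.
Proof.
move=> l_prime l_mod8.
have [k kE] : exists k, l = (k.*2.+1).*2.+1.*2.+1 by exists (l %/ 8); lia.
set m := k.*2.+1 in kE; have hE : l./2 = m.*2.+1 by lia.
have l0 : (l%:R = 0 :> 'F_l)%R by exact: pchar_Fp_0.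
pose g i : 'F_l := (2 * i.+1)%:R%R.
(* Reversing the order matches the factor 2 j + 1 with l - (2 j + 1), which is
   twice h - j. *)
have odd_part : (\prod_(j < m.+1) j.*2.+1%:R = \prod_(j < m.+1) g (m + j)%N :> 'F_l)%R.
  rewrite [RHS](reindex_inj rev_ord_inj) /=.
  transitivity (\prod_(j < m.+1) - g (m + (m.+1 - j.+1))%N : 'F_l)%R.
    apply: eq_bigr => j _; apply/eqP; rewrite -subr_eq0 opprK -natrD.
    by apply/eqP; rewrite -l0; congr (_%:R)%R; have := ltn_ord j; lia.
  by rewrite prodrN card_ord -signr_odd /m /= odd_double mul1r.
have fact_twice : (\prod_(i < l./2) i.+1%:R = \prod_(i < l./2) g i :> 'F_l)%R.
  rewrite hE (big_ord_parity (fun i => i.+1%:R)%R) odd_part -addnn -addnS big_split_ord /=.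
  by congr (_ * _)%R; apply: eq_bigr => j _; rewrite /g -doubleS -mul2n.
have fact_neq0 : (\prod_(i < l./2) i.+1%:R != 0 :> 'F_l)%R.
  apply/prodf_neq0 => i _; rewrite -(dvdn_pcharf (pchar_Fp l_prime)).
  by apply/negP => /dvdn_leq; have := ltn_ord i; lia.
apply: (mulIf fact_neq0); rewrite mul1r [RHS]fact_twice /g.
under [in RHS]eq_bigr do rewrite natrM.
by rewrite big_split prodr_const card_ord.
Qed.

(** With h = (l-1)/2 odd and d^h = 1, the element -d is not a square modulo l:
    raising i^2 = - d j^2 with i and j invertible to the power h gives 1 = -1 by
    Fermat. So i^2 + d j^2 = 0 forces i = j = 0 modulo l. *)
Lemma norm_form_dvd l d i j : prime l -> odd l -> odd l./2 ->
  (d%:R ^+ l./2 = 1 :> 'F_l)%R -> l %| i ^ 2 + d * j ^ 2 -> (l %| i) && (l %| j).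
Proof.
move=> l_prime l_odd h_odd d_pow l_dvd.
have lE : l = l./2.*2.+1 by lia.
have dvdE a : (l %| a) = (a%:R == 0 :> 'F_l)%R by exact: dvdn_pcharf (pchar_Fp l_prime) a.
have [l_j|l_j] := boolP (l %| j).
  rewrite andbT; move: l_dvd; rewrite dvdn_addl ?Euclid_dvdX ?andbT //.
  by rewrite dvdn_mull // Euclid_dvdX // l_j.
have unitpow (x : 'F_l) : (x != 0 -> x ^+ l./2.*2 = 1)%R.
  move=> x0; apply: (mulfI x0); rewrite -exprS -lE mulr1.
  by rewrite -[in RHS](expf_card x) card_Fp.
have j0 : (j%:R != 0 :> 'F_l)%R by rewrite -dvdE.
have eq_i : ((i%:R) ^+ 2 = - (d%:R * j%:R ^+ 2) :> 'F_l)%R.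
  by apply/eqP; rewrite -subr_eq0 opprK -!natrX -natrM -natrD -dvdE.
have : ((i%:R) ^+ l./2.*2 = -1 :> 'F_l)%R.
  rewrite -mul2n exprM eq_i exprNn exprMn d_pow -exprM mul2n unitpow // -signr_odd h_odd.
  by rewrite expr1 !mulr1.
have [->|i0] := eqVneq (i%:R)%R (0 : 'F_l)%R.
  rewrite expr0n; case: eqP => [|_ /eqP]; first by lia.
  by rewrite eq_sym oppr_eq0 oner_eq0.
rewrite unitpow // => /eqP; rewrite -subr_eq0 opprK -(natrD _ 1 1) -dvdE => /dvdn_leq.
by lia.
Qed.

Theorem theorem1p2 (n l r : nat) (l_prime : prime l) (l_odd : odd l)
    (l_mod8 : l = 7 %[mod 8]) (r_gt0 : 0 < r) (l_ndvd_r : ~~ (l %| r)) :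
  pbar (l ^ 2 * n + r * l) = 0 %[mod 16].
Proof.
have l_gt0 := prime_gt0 l_prime; have h_odd : odd l./2 by lia.
suff no_repr d : (d%:R ^+ l./2 = 1 :> 'F_l)%R ->
    forall i j, l ^ 2 * n + r * l != i ^ 2 + d * j ^ 2.
  apply: pbar_mod16 => i j; last by apply: no_repr; exact: two_pow_half.
  by rewrite -(mul1n (j ^ 2)); apply: no_repr; rewrite expr1n.
move=> d_pow i j; apply/eqP => repr.
have /andP[l_i l_j] : (l %| i) && (l %| j).
  apply: norm_form_dvd d_pow _ => //.
  rewrite -repr; apply: dvdn_add; last exact: dvdn_mull.
  by apply: dvdn_mulr; exact: dvdn_exp.
have : l ^ 2 %| l ^ 2 * n + r * l.
  by rewrite repr dvdn_add ?dvdn_exp2r // dvdn_mull ?dvdn_exp2r.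
rewrite (dvdn_addr _ (dvdn_mulr n (dvdnn _))) -mulnn dvdn_pmul2r //.
exact: negP.
Qed.
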